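(* Let $X$ be a topological space and $\alpha\in\omega_1$. The following are equivalent: (1) $X$ is $\alpha$-sequentially compact; (2) $X$ is $\mathcal{B}$-sequentially compact for every uniform barrier $\mathcal{B}$ on $\omega$ of rank $\alpha$; (3) $X$ is $\mathcal{B}$-sequentially compact for some uniform barrier $\mathcal{B}$ on $\omega$ of rank $\alpha$.
   Context: For sets of naturals, $s\sqsubseteq t$ means $s$ is an initial segment of $t$. For $\mathcal{F}\subseteq[\omega]^{<\omega}$ and $M\subseteq\omega$ let $\mathcal{F}|M=\{s\in\mathcal{F}:s\subseteq M\}$. A barrier on an infinite set $M\subseteq\omega$ is a family $\mathcal{B}$ of finite subsets of $M$ such that (a) $s\subseteq t$ implies $s=t$ for $s,t\in\mathcal{B}$, and (b) every infinite $N\subseteq M$ has an initial segment $s\sqsubseteq N$ with $s\in\mathcal{B}$. For $n\in M$ put $\mathcal{B}[n]=\{t\setminus\{n\}:t\in\mathcal{B},\ \min t=n\}$, which is a barrier on $M\setminus(n+1)$ when $\mathcal B\neq\{\emptyset\}$. Rank: $T(\mathcal{B})=\{s\in[\omega]^{<\omega}:\exists t\in\mathcal{B}\,(s\sqsubseteq t)\}$, $\rho_{T(\mathcal{B})}(s)=\sup\{\rho_{T(\mathcal{B})}(t)+1:t\in T(\mathcal{B}),\ s\sqsubseteq t,\ s\neq t\}$ (with $\sup\emptyset=0$), and $\rho(\mathcal{B})=\rho_{T(\mathcal{B})}(\emptyset)<\omega_1$. Uniform barriers, by recursion on rank: $\{\emptyset\}$ (rank $0$) and $[M]^1$ (rank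 $1$) are uniform; a barrier $\mathcal{B}$ on $M$ of rank $\alpha>1$ is uniform if each $\mathcal{B}[n]$ ($n\in M$) is a uniform barrier on $M\setminus(n+1)$ and either $\alpha=\beta+1$ and $\rho_{T(\mathcal{B})}(\{n\})=\beta$ for all $n\in M$, or $\alpha$ is a limit and $\{\rho_{T(\mathcal{B})}(\{n\}):n\in M\}$ is an increasing sequence with limit $\alpha$. If $\mathcal{B}$ is a barrier on an infinite set $M$, $f:\mathcal{B}\to X$ converges to $x\in X$ if for every open $U\ni x$ there is $n\in\omega$ with $f[\mathcal{B}|(M\setminus n)]\subseteq U$. For a barrier $\mathcal{B}$ on $\omega$, $X$ is $\mathcal{B}$-sequentially compact if for every $f:\mathcal{B}\to X$ there is an infinite $M\subseteq\omega$ such that $f\restriction(\mathcal{B}|M)$ converges to some point of $X$. For $\alpha<\omega_1$, $X$ is $\alpha$-sequentially compact if it is $\mathcal{B}$-sequentially compact for all barriers $\mathcal{B}$ on $\omega$ of rank $\alpha$. *)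

(* Defs.v *)
From HB Require Import structures.
From mathcomp Require Import all_boot all_order.
From mathcomp Require Import all_classical wochoice.
From mathcomp Require Import topology_structure.

Set Implicit Arguments.
Unset Strict Implicit.
Unset Printing Implicit Defensive.
Import Order.TTheory.

Local Open Scope classical_set_scope.

(* The ordinal omega_1: fix a well-ordering of the uncountable set 2^omega and
   keep the points with only countably many predecessors.  [omega1_min],
   [countable_initial] and [uncountable_omega1] below show that this is an
   uncountable well-order all of whose proper initial segments are countable,
   which determines it up to isomorphism. *)
Definition wo_continuum : rel (set nat) :=
  sval (well_ordering_principle (set nat)).

Lemma wo_continuumP : well_order wo_continuum.
Proof. exact: svalP (well_ordering_principle (set nat)). Qed.

Lemma wo_continuum_min (A : set (set nat)) : A !=set0 ->
  exists2 z, A z & forall x, A x -> wo_continuum z x.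
Proof.
move=> [a Aa]; have [|z [[Az lz] _]] := wo_continuumP (A := mem A).
  by exists a; apply/mem_set.
by exists z => [|x Ax]; [apply/set_mem | apply/lz/mem_set].
Qed.

Lemma wo_continuum_total : total wo_continuum.
Proof.
move=> x y; have [|z [->|->] lz] := @wo_continuum_min [set x; y].
- by exists x; left.
- by apply/orP; left; apply: lz; right.
- by apply/orP; right; apply: lz; left.
Qed.

Lemma wo_continuum_refl : reflexive wo_continuum.
Proof. by move=> x; have /orP[] := wo_continuum_total x x. Qed.

Lemma wo_continuum_anti : antisymmetric wo_continuum.
Proof.
move=> x y /andP[xy yx].
have [|z [_ uz]] := wo_continuumP (A := mem [set x; y]).
  by exists x; apply/mem_set; left.
have ux : z = x.
  apply: uz; split; first by apply/mem_set; left.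
  by move=> t /set_mem[->|->] //; exact: wo_continuum_refl.
have uy : z = y.
  apply: uz; split; first by apply/mem_set; right.
  by move=> t /set_mem[->|->] //; exact: wo_continuum_refl.
by rewrite -ux.
Qed.

Lemma wo_continuum_trans : transitive wo_continuum.
Proof.
move=> y x z xy yz.
have [|t tA lt] := @wo_continuum_min [set x; y; z].
  by exists x; left; left.
have [tx ty tz] : [/\ wo_continuum t x, wo_continuum t y & wo_continuum t z].
  by split; apply: lt; [left; left|left; right|right].
case: tA => [[<-|ty']|tz'] //.
  by rewrite (wo_continuum_anti (x := x) (y := y)) // xy -ty'.
by rewrite -(wo_continuum_anti (x := y) (y := z)) // yz -tz'.
Qed.

Definition omega1 : Type :=
  {x : set nat | `[< countable [set y | wo_continuum y x] >]}.

HB.instance Definition _ := Choice.copy omega1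
  {x : set nat | `[< countable [set y | wo_continuum y x] >]}.
HB.instance Definition _ := SubChoice.copy omega1
  {x : set nat | `[< countable [set y | wo_continuum y x] >]}.

Fact omega1_display : Order.disp_t. Proof. exact: (Order.Disp tt tt). Qed.

Definition le_omega1 (a b : omega1) : bool := wo_continuum (val a) (val b).

Fact le_omega1_refl : reflexive le_omega1.
Proof. by move=> a; exact: wo_continuum_refl. Qed.

Fact le_omega1_anti : antisymmetric le_omega1.
Proof. by move=> a b /wo_continuum_anti /val_inj. Qed.

Fact le_omega1_trans : transitive le_omega1.
Proof. by move=> b a c; exact: wo_continuum_trans. Qed.

Fact le_omega1_total : total le_omega1.
Proof. by move=> a b; exact: wo_continuum_total. Qed.

HB.instance Definition _ := Order.Le_isPOrder.Build omega1_display omega1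
  le_omega1_refl le_omega1_anti le_omega1_trans.
HB.instance Definition _ := Order.POrder_isTotal.Build omega1_display omega1
  le_omega1_total.

Lemma omega1_min (A : set omega1) : A !=set0 ->
  exists2 a, A a & forall b, A b -> (a <= b)%O.
Proof.
move=> [a Aa]; have [|_ [z Az <-] lz] := @wo_continuum_min [set val x | x in A].
  by exists (val a), a.
by exists z => // b Ab; apply: lz; exists b.
Qed.

Lemma countable_initial (a : omega1) : countable [set b : omega1 | (b <= a)%O].
Proof.
have /asboolP ca := valP a.
have [f fi] := countable_injP _ ca.
apply/countable_injP; exists (f \o val) => b c /set_mem bi /set_mem ci fbc.
by apply: val_inj; apply: fi fbc; apply/mem_set.
Qed.

Lemma uncountable_omega1 : ~ countable [set: omega1].
Proof.
move=> cW; pose S := [set x : set nat | ~ countable [set y | wo_continuum y x]].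
have [[z Sz lz]|S0] : (exists2 z, S z & forall x, S x -> wo_continuum z x)
    \/ S = set0.
- have [->|/set0P S0] := eqVneq S set0; first by right.
  by left; exact: wo_continuum_min.
- apply: Sz; have : countable ([set val x | x in [set: omega1]] `|` [set z]).
    rewrite -bigcup2E; apply: bigcup_countable => [|i _]; first exact: countableP.
    case: i => [|[|i]]; rewrite /bigcup2 //=.
    exact: sub_countable (card_image_le _ _) cW.
  apply/sub_countable/subset_card_le => y /= yz.
  have [->|yNz] := eqVneq y z; [by right | left].
  have cy : countable [set t | wo_continuum t y].
    apply: contrapT => /lz zy; move/eqP: yNz; apply.
    by apply: wo_continuum_anti; rewrite yz.
  by exists (Sub y (asboolT cy) : omega1).
have /countable_injP[f fi] : countable [set: set nat].
  suff -> : [set: set nat] = [set val x | x in [set: omega1]].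
    exact: sub_countable (card_image_le _ _) cW.
  apply/seteqP; split => // y _.
  have cy : countable [set t | wo_continuum t y].
    by apply: contrapT => Sy; have : S y by []; rewrite S0.
  by exists (Sub y (asboolT cy) : omega1).
pose D := [set n | exists2 A : set nat, f A = n & ~ A n].
have [DfD|NDfD] := pselect (D (f D)); last by apply: (NDfD); exists D.
by have [A /fi AD] := DfD; rewrite AD ?in_setT.
Qed.

Fact omega1_least_ex : exists a : omega1, forall b : omega1, (a <= b)%O.
Proof.
have [|a _ le_a] := @omega1_min setT; last by exists a => b; exact: le_a.
apply/set0P/eqP => W0; apply: uncountable_omega1.
by rewrite W0; exact: countable0.
Qed.

Definition ozero : omega1 := sval (cid omega1_least_ex).

Definition osucc (a : omega1) : omega1 :=
  infimum ozero [set b : omega1 | (a < b)%O].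

Definition osup (A : set omega1) : omega1 := supremum ozero A.

Definition is_limit (a : omega1) : Prop :=
  a <> ozero /\ ~ exists b, a = osucc b.

Lemma ozero_le (a : omega1) : (ozero <= a)%O.
Proof. exact: (svalP (cid omega1_least_ex)). Qed.

Lemma countable_ubound (A : set omega1) : countable A ->
  exists b : omega1, forall a, A a -> (a < b)%O.
Proof.
move=> cA; apply: contrapT => /forallNP nb; apply: uncountable_omega1.
have -> : [set: omega1] = \bigcup_(a in A) [set b | (b <= a)%O].
  apply/seteqP; split=> // b _; have /existsNP[a /not_implyP[Aa ab]] := nb b.
  by exists a => //=; rewrite leNgt; exact/negP.
by apply: bigcup_countable => // a _; exact: countable_initial.
Qed.

Lemma osupP (A : set omega1) : countable A -> forall b : omega1,
  (osup A <= b)%O <-> forall a, A a -> (a <= b)%O.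
Proof.
move=> /countable_ubound[c ub_c] b; rewrite /osup /supremum.
have [->|/set0P A0] := eqVneq A set0; first by split=> // _; exact: ozero_le.
have : exists s, supremums A s.
  have [|s us ls] := @omega1_min (ubound A).
    by exists c => a /ub_c/ltW.
  by exists s.
move=> /xgetPex => /(_ ozero) [us ls].
split=> [sb a Aa|ub]; first by apply: le_trans sb; exact: us.
exact: ls.
Qed.

Lemma osuccP (a b : omega1) : (osucc a <= b)%O <-> (a < b)%O.
Proof.
rewrite /osucc /infimum; set A := [set b | _].
have [c ac] := countable_ubound (countable1 a).
have /set0P/negPf-> : A !=set0 by exists c; exact: ac.
have [|m Am lm] := @omega1_min A; first by exists c; exact: ac.
have : exists s, infimums A s by exists m; split=> // l; exact.
move=> /xgetPex => /(_ ozero) [ls us]; split=> [sb|]; last exact: ls.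
by apply: lt_le_trans sb; apply: lt_le_trans Am _; exact: us.
Qed.

Definition init_seg (s t : set nat) : Prop :=
  s `<=` t /\ forall m n, s m -> t n -> n < m -> s n.

Definition restrict_family (F : set (set nat)) (M : set nat) : set (set nat) :=
  [set s | F s /\ s `<=` M].

Definition barrier (M : set nat) (B : set (set nat)) : Prop :=
  [/\ infinite_set M,
      forall s, B s -> finite_set s /\ s `<=` M,
      forall s t, B s -> B t -> s `<=` t -> s = t &
      forall N, infinite_set N -> N `<=` M -> exists2 s, B s & init_seg s N].

Definition is_min (n : nat) (t : set nat) : Prop :=
  t n /\ forall m, t m -> n <= m.

Definition section_family (B : set (set nat)) (n : nat) : set (set nat) :=
  [set t `\ n | t in [set t | B t /\ is_min n t]].

Definition tree (B : set (set nat)) : set (set nat) :=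
  [set s | finite_set s /\ exists2 t, B t & init_seg s t].

Definition tree_ext (T : set (set nat)) (t s : set nat) : Prop :=
  [/\ T t, init_seg s t & s <> t].

(* The rank is defined by well-founded recursion; it is given the junk value
   [ozero] outside the well-founded part of T, which is everything when T is
   the tree of a barrier, see [tree_ext_wf]. *)
Definition tree_rank (T : set (set nat)) (s : set nat) : omega1 :=
  match pselect (Acc (tree_ext T) s) with
  | left s_acc =>
      Fix_F (fun _ => omega1)
        (fun s rec => osup [set a | exists t, exists ts : tree_ext T t s,
                                    a = osucc (rec t ts)])
        s_acc
  | right _ => ozero
  end.

Lemma tree_rankE (T : set (set nat)) (s : set nat) : Acc (tree_ext T) s ->
  tree_rank T s =
  osup [set osucc (tree_rank T t) | t in [set t | tree_ext T t s]].
Proof.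
move=> s_acc; rewrite {1}/tree_rank; case: pselect => // {}s_acc.
rewrite -Fix_F_eq; congr osup; apply/seteqP.
have rankE t (ts : tree_ext T t s) : tree_rank T t =
    Fix_F (fun _ => omega1)
        (fun s rec => osup [set a | exists t, exists ts : tree_ext T t s,
                                    a = osucc (rec t ts)])
        (Acc_inv s_acc ts).
  rewrite /tree_rank; case: pselect => [t_acc|[]]; last exact: Acc_inv ts.
  by congr Fix_F; exact: Prop_irrelevance.
split=> [_ [t [ts ->]]|_ [t ts <-]].
  by exists t => //; rewrite (rankE _ ts).
by exists t, ts; rewrite (rankE _ ts).
Qed.

Lemma tree_ext_wf (M : set nat) (B : set (set nat)) : barrier M B ->
  well_founded (tree_ext (tree B)).
Proof.
move=> [Minf Bfin Banti Bdense] s0; apply: contrapT => s0N.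
have step (s : {s | ~ Acc (tree_ext (tree B)) s}) :
    {t : {s | ~ Acc (tree_ext (tree B)) s} | tree_ext (tree B) (sval t) (sval s)}.
  case: s => s sN /=; apply: cid; apply: contrapT => /forallNP noext.
  apply: sN; constructor => t ts; apply: contrapT => tN.
  exact: (noext (exist _ t tN)).
pose c := fix c n := if n is n'.+1 then sval (step (c n')) else exist _ s0 s0N.
pose u n := sval (c n.+1).
have uT n : tree B (u n) by have [] := svalP (step (c n)).
have uS n : tree_ext (tree B) (u n.+1) (u n) by exact: (svalP (step (c n.+1))).
have u_mono m n : m <= n -> u m `<=` u n.
  elim: n => [|n IH]; first by rewrite leqn0 => /eqP->.
  rewrite leq_eqVlt => /orP[/eqP->//|/IH umn].
  by apply: (subset_trans umn); have [_ []] := uS n.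
have useg m n : init_seg (u m) (u (m + n)).
  elim: n => [|n [sub seg]]; first by rewrite addn0; split.
  rewrite addnS; have [_ [sub' seg'] _] := uS (m + n).
  split=> [i /sub/sub'//|i j ui uj ji].
  by apply: (seg i j) => //; apply: (seg' i j) => //; exact: sub.
pose N : set nat := \bigcup_n u n.
have stab (s : set nat) : finite_set s -> s `<=` N -> exists k, s `<=` u k.
  move=> /finite_seqP[l ->]; elim: l => [|x l IH] sN; first by exists 0.
  have [|k lk] := IH.
    by move=> y yl; apply: sN; rewrite /= inE; apply/orP; right.
  have [|k' _ xk'] := sN x; first by rewrite /= inE eqxx.
  exists (maxn k k') => y /=; rewrite inE => /orP[/eqP->|yl].
    by apply: u_mono xk'; exact: leq_maxr.
  by apply: (@u_mono k); [exact: leq_maxl | exact: lk].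
have strict k : ~ u k.+1 `<=` u k.
  by move=> sub; have [_ [sub' _]] := uS k; apply; apply/seteqP.
have Ninf : infinite_set N.
  move=> /stab-/(_ (@subset_refl _ _))[k Nk].
  by apply: (strict k) => i ui; apply: Nk; exists k.+1.
have NM : N `<=` M.
  move=> i [n _ ui]; have [_ [t Bt [ut _]]] := uT n.
  by have [_ tM] := Bfin _ Bt; exact/tM/ut.
have [s Bs [sN _]] := Bdense _ Ninf NM; have [sfin _] := Bfin _ Bs.
have [k sk] := stab _ sfin sN.
have [_ [t Bt [ut _]]] := uT k.+1; apply: (strict k).
have st : s = t.
  apply: Banti => //; apply: (subset_trans sk); apply: subset_trans ut.
  exact: u_mono.
by apply: subset_trans sk; rewrite st.
Qed.

Definition barrier_rank (B : set (set nat)) : omega1 := tree_rank (tree B) set0.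

Inductive uniform_barrier : set nat -> set (set nat) -> Prop :=
| uniform_barrier0 M of infinite_set M :
    uniform_barrier M [set set0]
| uniform_barrier1 M of infinite_set M :
    uniform_barrier M [set [set n] | n in M]
| uniform_barrierS M B beta of barrier M B &
    (osucc ozero < barrier_rank B)%O &
    (forall n, M n -> uniform_barrier (M `\` `I_n.+1) (section_family B n)) &
    barrier_rank B = osucc beta &
    (forall n, M n -> tree_rank (tree B) [set n] = beta) :
    uniform_barrier M B
| uniform_barrier_lim M B of barrier M B &
    (osucc ozero < barrier_rank B)%O &
    (forall n, M n -> uniform_barrier (M `\` `I_n.+1) (section_family B n)) &
    is_limit (barrier_rank B) &
    (forall m n, M m -> M n -> m < n ->
       (tree_rank (tree B) [set m] < tree_rank (tree B) [set n])%O) &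
    osup [set tree_rank (tree B) [set n] | n in M] = barrier_rank B :
    uniform_barrier M B.

(* A function f : B -> X is given by a function on all sets of naturals, whose
   values outside B are irrelevant.  Since barriers are nonempty, this is
   harmless even when X is empty. *)
Definition barrier_cvg (X : topologicalType) (M : set nat) (B : set (set nat))
    (f : set nat -> X) (x : X) : Prop :=
  forall U : set X, open U -> U x ->
    exists n : nat, f @` restrict_family B (M `\` `I_n) `<=` U.

Definition barrier_seq_compact (X : topologicalType) (B : set (set nat)) : Prop :=
  forall f : set nat -> X, exists2 M : set nat, infinite_set M &
    exists x : X, barrier_cvg M (restrict_family B M) f x.

Definition ordinal_seq_compact (X : topologicalType) (alpha : omega1) : Prop :=
  forall B, barrier setT B -> barrier_rank B = alpha -> barrier_seq_compact X B.

(* Main.v *)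
(* Let B be a uniform barrier and C any barrier with rank C <= rank B.  Uniformity
   says that for s in the tree of B and b < rank_B(s), almost all m satisfy
   b <= rank_B(s u {m}).  Hence, if h : nat -> nat tends to infinity slowly enough,
   every infinite set can be thinned to an infinite M on which h is increasing and,
   for s a finite subset of M, either h[s] has an initial segment in C or
   rank_C(h[s]) <= rank_B(s).  Elements of B have rank 0, so every s in B|M
   determines an initial segment c(s) in C of h[s].  Given f : C -> X, convergence of
   f o c on B|M yields convergence of f on C|h[M].

   A uniform barrier of each rank is obtained by induction, gluing barriers E_n on
   the integers above n into {{n} u s : s in E_n}.  For the result to be an
   inclusion-antichain one wants each member of E_n to contain a member of E_m when
   m < n; in the limit case the E_n are pullbacks of uniform barriers of increasing
   ranks along a fast-growing map. *)
Require Import Defs.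
From mathcomp Require Import all_boot all_order.
From mathcomp Require Import all_classical.
From mathcomp Require Import topology_structure.
From mathcomp Require Import zify.

Set Implicit Arguments.
Unset Strict Implicit.
Unset Printing Implicit Defensive.
Import Order.TTheory.

Local Open Scope classical_set_scope.

(** * Initial segments and finite sets of integers *)

Lemma finite_set_sub_I (s : set nat) : finite_set s -> exists k, s `<=` `I_k.
Proof.
move=> /finite_seqP[l ->]; elim: l => [|x l [k lk]]; first by exists 0.
exists (maxn x.+1 k) => y /=; rewrite inE => /orP[/eqP->|/lk /=]; lia.
Qed.

Lemma infinite_set_unbounded (M : set nat) (k : nat) :
  infinite_set M -> exists2 m, M m & k <= m.
Proof.
move=> Minf; apply: contrapT => nM; apply: Minf.
apply: sub_finite_set (finite_II k) => m Mm /=; rewrite ltnNge.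
by apply/negP => km; apply: nM; exists m.
Qed.

Lemma unbounded_infinite_set (M : set nat) :
  (forall k, exists2 m, M m & k <= m) -> infinite_set M.
Proof.
move=> ub /finite_set_sub_I[k Mk]; have [m /Mk/= mk km] := ub k; lia.
Qed.

Lemma countable_finite_sets (A : set (set nat)) :
  A `<=` [set s | finite_set s] -> countable A.
Proof.
move=> Afin; apply: (@sub_countable _ _ A [set [set` l] | l in [set: seq nat]]).
  by apply: subset_card_le => s /Afin/finite_seqP[l ->]; exists l.
exact: sub_countable (card_image_le _ _) (countableP _).
Qed.

Lemma init_seg_refl (s : set nat) : init_seg s s.
Proof. by split=> // m n _ sn. Qed.

Lemma init_seg_trans (t s u : set nat) :
  init_seg s t -> init_seg t u -> init_seg s u.
Proof.
move=> [st st'] [tu tu']; split=> [|m n sm un nm]; first exact: subset_trans tu.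
by apply: (st' m) => //; apply: (tu' m) => //; exact: st.
Qed.

Lemma init_seg_comparable (N s t : set nat) :
  init_seg s N -> init_seg t N -> init_seg s t \/ init_seg t s.
Proof.
move=> [sN sN'] [tN tN']; have [st|] := pselect (s `<=` t).
  by left; split=> // m n sm tn; apply: sN' => //; exact: tN.
move=> /existsNP[x /not_implyP[sx ntx]].
have ts : t `<=` s.
  move=> y ty; have [yx|xy|yx] := ltngtP y x; last by rewrite yx.
    by apply: (sN' x) => //; exact: tN.
  by exfalso; apply: ntx; apply: (tN' y) => //; exact: sN.
by right; split=> // m n tm sn; apply: tN' => //; exact: sN.
Qed.

Lemma init_seg0 (s : set nat) : init_seg set0 s.
Proof. by split. Qed.

Lemma init_segU1 (s : set nat) (m : nat) : s `<=` `I_m -> init_seg s (m |` s).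
Proof.
move=> sm; split=> [x sx|x y sx [->|//]]; first by right.
by move=> mx; have /= := sm _ sx; lia.
Qed.

(** Density of a barrier speaks of infinite sets only; a finite set is completed by a tail of [M]
    beyond it so that density applies. *)
Lemma init_seg_extend (M s : set nat) : infinite_set M -> finite_set s ->
  s `<=` M -> exists N, [/\ infinite_set N, N `<=` M & init_seg s N].
Proof.
move=> Minf /finite_set_sub_I[k sk] sM.
exists (s `|` (M `\` `I_k)); split.
- by apply: sub_infinite_set (infinite_setD Minf (finite_II k)) => x; right.
- by move=> x [/sM|[]].
- split=> [x sx|x y /sk/= xk]; first by left.
  by move=> [//|[_ /= yk]] yx; case: yk; lia.
Qed.

Lemma strict_mono_inj (h : nat -> nat) :
  {homo h : m n / m < n} -> injective h.
Proof.
move=> hmono m n hmn; have [/hmono|/hmono|//] := ltngtP m n; rewrite hmn; lia.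
Qed.

Lemma image_inj_sub (h : nat -> nat) (s t : set nat) : injective h ->
  h @` s `<=` h @` t -> s `<=` t.
Proof. by move=> hi st x sx; have [|y ty /hi<-] := st (h x); first by exists x. Qed.

Lemma image_inj_eq (h : nat -> nat) (s t : set nat) : injective h ->
  h @` s = h @` t -> s = t.
Proof.
by move=> hi st; apply/seteqP; split; apply: (image_inj_sub hi); rewrite st.
Qed.

Lemma image_inj_finite (h : nat -> nat) (s : set nat) : injective h ->
  finite_set (h @` s) -> finite_set s.
Proof.
move=> hi /(@finite_preimage _ _ _ h) fs.
apply: sub_finite_set (fs _) => [x sx|x y _ _ /hi//]; first by exists x.
Qed.

Lemma image_U1 (h : nat -> nat) (m : nat) (s : set nat) :
  h @` (m |` s) = h m |` h @` s.
Proof. by rewrite image_setU image_set1. Qed.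

Lemma sub_I_split (n : nat) (s : set nat) : s `<=` `I_n.+1 ->
  s `<=` `I_n \/ exists2 t, t `<=` `I_n & s = n |` t.
Proof.
move=> sn; have [sn'|sn'] := pselect (s n); last first.
  left=> x sx /=; have /= := sn _ sx; rewrite ltnS leq_eqVlt => /orP[/eqP xn|//].
  by rewrite xn in sx.
right; exists (s `\ n); last by rewrite setD1K.
by move=> x [/= sx xn]; have /= := sn _ sx; move/eqP in xn; lia.
Qed.

(** Only finitely many thresholds have to be maximised: the induction splits the subsets of [0, n]
    according to whether they contain [n]. *)
Lemma eventually_powerset (n : nat) (P : set nat -> nat -> Prop) :
  (forall s, s `<=` `I_n -> exists k, forall m, k <= m -> P s m) ->
  exists k, forall s m, s `<=` `I_n -> k <= m -> P s m.
Proof.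
elim: n P => [|n IH] P H.
  have [k kP] := H _ (@sub0set _ _); exists k => s m s0 km.
  suff -> : s = set0 by exact: kP.
  by rewrite -subset0 => x /s0.
have [s sn|k1 k1P] := IH P; first by apply: H => x /sn /=; lia.
have [s sn|k2 k2P] := IH (fun s => P (n |` s)).
  by apply: H => x [->|/sn] /=; lia.
exists (maxn k1 k2) => s m /sub_I_split[sn|[t tn ->]]; rewrite geq_max => /andP[? ?].
  exact: k1P.
exact: k2P.
Qed.

Lemma eventually_bounded (n : nat) (P : nat -> nat -> Prop) :
  (forall i, i < n -> exists k, forall m, k <= m -> P i m) ->
  exists k, forall i m, i < n -> k <= m -> P i m.
Proof.
elim: n => [|n IH] H; first by exists 0.
have [i ilt|k1 k1P] := IH; first by apply: H; lia.
have [//|k2 k2P] := H n.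
exists (maxn k1 k2) => i m; rewrite ltnS leq_eqVlt geq_max.
move=> /orP[/eqP->|ilt] /andP[? ?].
  exact: k2P.
exact: k1P.
Qed.

(** Complete [s] to an infinite set; the member of [C] that begins it and [s] are initial segments
    of one set, hence comparable. *)
Lemma barrier_dichotomy (C : set (set nat)) (s : set nat) :
  barrier setT C -> finite_set s ->
  (exists2 t, C t & init_seg t s) \/ tree C s.
Proof.
move=> [Tinf _ _ dense] sfin.
have [//|N [Ninf NT sN]] := @init_seg_extend setT s Tinf sfin.
have [t Ct tN] := dense _ Ninf NT.
have [ts|st] := init_seg_comparable tN sN; first by left; exists t.
by right; split=> //; exists t.
Qed.

(** * Ranks and sections of barriers *)

Lemma lt_osucc (a b : omega1) : (b < osucc a)%O = (b <= a)%O.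
Proof. by rewrite ltNge (leNgt b); congr (~~ _); apply/idP/idP => /osuccP. Qed.

(** Ranks are suprema, known through their upper bounds; equalities of ranks are obtained by
    comparing these. *)
Lemma le_omega1_ext (a b : omega1) :
  (forall c, (a <= c)%O <-> (b <= c)%O) -> a = b.
Proof. by move=> ab; apply: le_anti; rewrite (ab b).2// (ab a).1. Qed.

(** There are only countably many finite sets, so [osup] is a true supremum here and the rank
    recursion unfolds to its universal property. *)
Lemma tree_rank_leP (B : set (set nat)) (s : set nat) (b : omega1) :
  Acc (tree_ext (tree B)) s ->
  (tree_rank (tree B) s <= b)%O <->
  forall t, tree_ext (tree B) t s -> (tree_rank (tree B) t < b)%O.
Proof.
move=> s_acc; rewrite tree_rankE// osupP; last first.
  apply: (sub_countable (card_image_le _ _)).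
  by apply: countable_finite_sets => t [[]].
split=> [H t ts|H _ [t ts <-]]; last exact/osuccP/H.
by apply/osuccP/H; exists t.
Qed.

Lemma tree_rank_lt (M : set nat) (B : set (set nat)) (s t : set nat) :
  barrier M B -> tree_ext (tree B) t s ->
  (tree_rank (tree B) t < tree_rank (tree B) s)%O.
Proof.
move=> bB ts; have [H _] := tree_rank_leP (tree_rank (tree B) s) (tree_ext_wf bB s).
exact: H (lexx _) _ ts.
Qed.

Lemma tree_rank_mono (M : set nat) (B : set (set nat)) (s t : set nat) :
  barrier M B -> tree B t -> init_seg s t ->
  (tree_rank (tree B) t <= tree_rank (tree B) s)%O.
Proof.
move=> bB Tt st; have [->//|nst] := pselect (s = t).
exact/ltW/(tree_rank_lt bB).
Qed.

Lemma sub_tree (M : set nat) (B : set (set nat)) : barrier M B -> B `<=` tree B.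
Proof.
move=> [_ Bfin _ _] s Bs; split; first by have [] := Bfin _ Bs.
by exists s => //; exact: init_seg_refl.
Qed.

(** Any node extending [s] lies inside a member of [B], and the antichain property makes that member
    [s] itself. *)
Lemma tree_rank_leaf (M : set nat) (B : set (set nat)) (s : set nat) :
  barrier M B -> B s -> tree_rank (tree B) s = ozero.
Proof.
move=> bB Bs; apply: le_anti; rewrite ozero_le andbT.
apply/tree_rank_leP; first exact: tree_ext_wf bB _.
move=> t [[_ [u Bu [tu _]]] st nst]; case: nst; apply/seteqP.
have [_ _ anti _] := bB; have su : s = u.
  by apply: anti => //; case: st => st _; exact: subset_trans tu.
by split; [case: st|rewrite su].
Qed.

(** A node that is not a member has a strict extension in [C], which forces positive rank. Outside
    the tree the dichotomy supplies the member of [C]. *)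
Lemma tree_rank0_leaf (C : set (set nat)) (s : set nat) :
  barrier setT C -> finite_set s -> (tree_rank (tree C) s <= ozero)%O ->
  exists2 t, C t & init_seg t s.
Proof.
move=> bC sfin r0; have [//|[_ [u Cu su]]] := barrier_dichotomy bC sfin.
have [->|nsu] := pselect (s = u); first by exists u => //; exact: init_seg_refl.
have /(tree_rank_lt bC) : tree_ext (tree C) u s by split=> //; exact: sub_tree bC _ _.
by rewrite ltNge (le_trans r0 (ozero_le _)).
Qed.

Lemma barrier_set0 (M : set nat) (B : set (set nat)) :
  barrier M B -> B set0 -> B = [set set0].
Proof.
move=> [_ _ anti _] B0; apply/seteqP; split=> [s Bs|_ -> //].
by rewrite /= -(anti set0 s).
Qed.

Lemma is_min_ex (s : set nat) : s !=set0 -> exists n, is_min n s.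
Proof.
move=> [x sx]; have ex : exists n, `[< s n >] by exists x; apply/asboolP.
exists (ex_minn ex); case: ex_minnP => m /asboolP sm min; split=> // k sk.
by apply: min; apply/asboolP.
Qed.

Lemma is_min_U1 (n : nat) (s : set nat) : s `<=` ~` `I_n.+1 -> is_min n (n |` s).
Proof. by move=> sn; split=> [|m [->//|/sn/=]]; [left|lia]. Qed.

Lemma is_minD1 (n : nat) (s : set nat) : is_min n s -> s `\ n `<=` ~` `I_n.+1.
Proof. by move=> [_ min] m [/min + /= /eqP]; lia. Qed.

Lemma setU1D1 (n : nat) (s : set nat) : s `<=` ~` `I_n.+1 -> (n |` s) `\ n = s.
Proof.
move=> sn; apply/seteqP; split=> [x [[->|//] []]//|x sx]; split; first by right.
by move=> xn; have /= := sn _ sx; rewrite xn; lia.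
Qed.

Lemma min_init_seg (n : nat) (s t : set nat) :
  init_seg s t -> is_min n s -> is_min n t.
Proof.
move=> [st st'] [sn min]; split=> [|m tm]; first exact: st.
by rewrite leqNgt; apply/negP => mn; have := min _ (st' _ _ sn tm mn); lia.
Qed.

Lemma init_segU1P (n : nat) (s t : set nat) :
  s `<=` ~` `I_n.+1 -> t `<=` ~` `I_n.+1 ->
  init_seg (n |` s) (n |` t) <-> init_seg s t.
Proof.
move=> sn tn; split=> -[st st']; split.
- by move=> x sx; have [|/= xn|//] := st x; [right|have /= := sn _ sx; lia].
- move=> x y sx ty yx; have [||//|/= yn|//] := st' x y; [by right|by right|].
  by have /= := tn _ ty; lia.
- by move=> x [->|/st]; [left|right].
- move=> x y [->|sx] [->|ty] yx; [by left| |by left|right; exact: st' yx].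
  by have /= := tn _ ty; lia.
Qed.

Lemma section_familyP (B : set (set nat)) (n : nat) (s : set nat) :
  section_family B n s <-> s `<=` ~` `I_n.+1 /\ B (n |` s).
Proof.
split=> [[t [Bt tn] <-]|[sn Bs]].
  by split; [exact: is_minD1|rewrite setD1K//; case: tn].
by exists (n |` s); [split=> //; exact: is_min_U1|exact: setU1D1].
Qed.

Lemma tree_sectionP (B : set (set nat)) (n : nat) (s : set nat) :
  s `<=` ~` `I_n.+1 -> tree (section_family B n) s <-> tree B (n |` s).
Proof.
move=> sn; split=> -[sfin [t]].
  move=> /section_familyP[tn Bt] st; split; first by rewrite finite_setU.
  by exists (n |` t) => //; exact/init_segU1P.
move=> Bt st; have tn : is_min n t by apply: (min_init_seg st); exact: is_min_U1.
split; first by apply: sub_finite_set sfin => x; right.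
exists (t `\ n).
  by apply/section_familyP; split; [exact: is_minD1|rewrite setD1K//; case: tn].
by apply/(init_segU1P sn (is_minD1 tn)); rewrite setD1K//; case: tn.
Qed.

(** Adding [n] is an isomorphism from the tree of the section onto the part of the tree of [B] above
    {n}, and a rank depends only on the extensions; hence an induction along extensions. *)
Lemma tree_rank_section (M N : set nat) (B : set (set nat)) (n : nat) (s : set nat) :
  barrier M B -> barrier N (section_family B n) -> s `<=` ~` `I_n.+1 ->
  tree_rank (tree (section_family B n)) s = tree_rank (tree B) (n |` s).
Proof.
move=> bB bBn; have := tree_ext_wf bBn s; elim=> {}s _ IH sn.
apply: le_omega1_ext => c; rewrite tree_rank_leP; last exact: tree_ext_wf bBn _.
rewrite tree_rank_leP; last exact: tree_ext_wf bB _.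
split=> H t [Tt st nst].
  have tn : is_min n t by apply: (min_init_seg st); exact: is_min_U1.
  have tnE : n |` (t `\ n) = t by rewrite setD1K//; case: tn.
  have ext : tree_ext (tree (section_family B n)) (t `\ n) s.
    split; first by apply/(tree_sectionP _ (is_minD1 tn)); rewrite tnE.
      by apply/(init_segU1P sn (is_minD1 tn)); rewrite tnE.
    by move=> sE; apply: nst; rewrite sE tnE.
  by have := H _ ext; rewrite IH ?tnE//; exact: is_minD1.
have tn : t `<=` ~` `I_n.+1.
  have [_ [u /section_familyP[un _] [tu _]]] := Tt.
  exact: subset_trans tu un.
rewrite IH//; apply: H; split; first exact/tree_sectionP.
  exact/init_segU1P.
by move=> sE; apply: nst; rewrite -(setU1D1 sn) sE setU1D1.
Qed.

Lemma barrier_rank_section (M N : set nat) (B : set (set nat)) (n : nat) :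
  barrier M B -> barrier N (section_family B n) ->
  barrier_rank (section_family B n) = tree_rank (tree B) [set n].
Proof.
move=> bB bBn; rewrite /barrier_rank (tree_rank_section bB bBn) ?setU0//.
Qed.

Lemma tree_set1 (M : set nat) (B : set (set nat)) (n : nat) :
  barrier M B -> ~ B set0 -> M n -> tree B [set n].
Proof.
move=> [Minf _ _ dense] nB0 Mn.
have [| |N [Ninf NM nN]] := @init_seg_extend M [set n] Minf.
- exact: finite_set1.
- by move=> _ ->.
split; first exact: finite_set1.
have [s Bs sN] := dense _ Ninf NM; exists s => //.
have [//|[sn _]] := init_seg_comparable nN sN.
have [s0|/set0P[x sx]] := eqVneq s set0; first by rewrite s0 in Bs.
have <- : s = [set n].
  by apply/seteqP; split=> // y ->; rewrite -(sn _ sx).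
exact: init_seg_refl.
Qed.

(** Each nonempty node extends the singleton of its minimum, a node of at least the same rank, so
    the singletons decide the supremum. *)
Lemma barrier_rank_leP (M : set nat) (B : set (set nat)) (b : omega1) :
  barrier M B -> ~ B set0 ->
  (barrier_rank B <= b)%O <->
  forall n, M n -> (tree_rank (tree B) [set n] < b)%O.
Proof.
move=> bB nB0; rewrite /barrier_rank tree_rank_leP; last exact: tree_ext_wf bB _.
split=> [H n Mn|H t [Tt _ nt]].
  apply: H; split; [exact: tree_set1 bB nB0 Mn|exact: init_seg0|].
  by move=> E; have : [set n] n by []; rewrite -E.
have /set0P/is_min_ex[n [tn min]] : t != set0 by apply/eqP => t0; apply: nt.
have Mn : M n.
  by have [_ [u Bu [tu _]]] := Tt; have [_ /(_ _ Bu)[_ uM] _ _] := bB; exact/uM/tu.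
apply: le_lt_trans (H _ Mn); apply: (tree_rank_mono bB Tt).
split=> [_ ->//|_ m -> tm mn]; have := min _ tm; lia.
Qed.

(** * Uniform barriers *)

Lemma barrier_singletons (M : set nat) :
  infinite_set M -> barrier M [set [set n] | n in M].
Proof.
move=> Minf; split=> //.
- by move=> _ [n Mn <-]; split; [exact: finite_set1|move=> _ ->].
- by move=> _ _ [m Mm <-] [n Nn <-] /(_ m erefl) ->.
- move=> N Ninf NM; have [n [Nn min]] := is_min_ex (infinite_setN0 Ninf).
  exists [set n]; first by exists n => //; exact: NM.
  by split=> [_ ->//|_ j -> /min]; lia.
Qed.

Lemma uniform_is_barrier (M : set nat) (B : set (set nat)) :
  uniform_barrier M B -> barrier M B.
Proof.
case=> {M B} // M Minf; last exact: barrier_singletons.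
split=> //.
- by move=> _ ->; split; [exact: finite_set0|exact: sub0set].
- by move=> _ _ -> ->.
- by move=> N _ _; exists set0 => //; exact: init_seg0.
Qed.

Lemma barrier_rank_singletons (M : set nat) : infinite_set M ->
  barrier_rank [set [set n] | n in M] = osucc ozero.
Proof.
move=> Minf; have bB := barrier_singletons Minf.
have leaf n : M n -> tree_rank (tree [set [set n] | n in M]) [set n] = ozero.
  by move=> Mn; apply: (tree_rank_leaf bB); exists n.
apply: le_omega1_ext => c; rewrite (barrier_rank_leP _ bB); last first.
  by move=> [n _ /seteqP[/(_ n erefl)]].
rewrite osuccP; split=> [H|H n /leaf ->//].
by have [n Mn] := infinite_setN0 Minf; rewrite -(leaf n Mn); exact: H.
Qed.

Lemma barrier_rank_set0 (M : set nat) (B : set (set nat)) :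
  barrier M B -> B set0 -> barrier_rank B = ozero.
Proof. by move=> bB; exact: tree_rank_leaf bB. Qed.

Lemma barrier_rank0 (M : set nat) (B : set (set nat)) :
  barrier M B -> barrier_rank B = ozero -> B = [set set0].
Proof.
move=> bB r0; apply: (barrier_set0 bB); apply: contrapT => nB0.
have := barrier_rank_leP ozero bB nB0; rewrite r0 lexx => -[/(_ isT) H _].
have [/infinite_setN0[n Mn] _ _ _] := bB.
by have := H n Mn; rewrite ltNge ozero_le.
Qed.

Lemma uniform_succ (M : set nat) (B : set (set nat)) (beta : omega1) :
  barrier M B -> ~ B set0 ->
  (forall n, M n -> uniform_barrier (M `\` `I_n.+1) (section_family B n)) ->
  (forall n, M n -> barrier_rank (section_family B n) = beta) ->
  uniform_barrier M B /\ barrier_rank B = osucc beta.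
Proof.
move=> bB nB0 uS rS; have [Minf Bfin _ _] := bB.
have rk n : M n -> tree_rank (tree B) [set n] = beta.
  move=> Mn; rewrite -(rS n Mn).
  by rewrite (barrier_rank_section bB (uniform_is_barrier (uS n Mn))).
have rB : barrier_rank B = osucc beta.
  apply: le_omega1_ext => c; rewrite (barrier_rank_leP _ bB nB0) osuccP.
  split=> [H|H n /rk ->//].
  by have [n Mn] := infinite_setN0 Minf; rewrite -(rk n Mn); exact: H.
(* The successor constructor asks for rank above 1. If [beta] is zero, every section is {∅} and [B]
   consists of the singletons. *)
split=> //; have [b0|b0] := eqVneq beta ozero; last first.
  apply: (uniform_barrierS bB _ uS rB rk).
  by rewrite rB lt_osucc; apply/osuccP; rewrite lt_neqAle eq_sym b0 ozero_le.
have sec n : M n -> section_family B n = [set set0].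
  move=> Mn; apply: (barrier_rank0 (uniform_is_barrier (uS n Mn))).
  by rewrite rS.
suff -> : B = [set [set n] | n in M] by exact: uniform_barrier1.
apply/seteqP; split=> [s Bs|_ [n Mn <-]]; last first.
  have : section_family B n set0 by rewrite sec.
  by move=> /section_familyP[_]; rewrite setU0.
have /set0P/is_min_ex[n sn] : s != set0 by apply/eqP => s0; rewrite s0 in Bs.
have Mn : M n by apply: (Bfin _ Bs).2; case: sn.
exists n => //; have : section_family B n (s `\ n) by exists s.
by rewrite sec// => /= s0; rewrite -(@setD1K _ n s) ?s0 ?setU0//; case: sn.
Qed.

Lemma uniform_limit (M : set nat) (B : set (set nat)) (alpha : omega1) :
  barrier M B -> ~ B set0 -> is_limit alpha ->
  (forall n, M n -> uniform_barrier (M `\` `I_n.+1) (section_family B n)) ->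
  (forall m n, M m -> M n -> m < n ->
    (barrier_rank (section_family B m) < barrier_rank (section_family B n))%O) ->
  (forall b, (forall n, M n -> (barrier_rank (section_family B n) <= b)%O) <->
    (alpha <= b)%O) ->
  uniform_barrier M B /\ barrier_rank B = alpha.
Proof.
move=> bB nB0 lim uS inc sup; have [Minf _ _ _] := bB.
have rk n : M n -> barrier_rank (section_family B n) = tree_rank (tree B) [set n].
  by move=> Mn; rewrite (barrier_rank_section bB (uniform_is_barrier (uS n Mn))).
have rB : barrier_rank B = alpha.
  apply: le_omega1_ext => c; rewrite (barrier_rank_leP _ bB nB0) -sup.
  split=> H n Mn; first by rewrite rk//; exact/ltW/H.
  (* The weak bound at a later point [m] gives the strict bound at [n], since the ranks increase. *)
  have [m Mm nm] := infinite_set_unbounded n.+1 Minf.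
  by rewrite -rk//; apply: lt_le_trans (H m Mm); exact: inc.
split=> //; apply: (uniform_barrier_lim bB _ uS).
- rewrite rB lt_neqAle; case: lim => n0 nS; apply/andP; split.
    by apply/eqP => E; apply: nS; exists ozero.
  by apply/osuccP; rewrite lt_neqAle ozero_le andbT; apply/eqP => E; exact: n0.
- by rewrite rB.
- by move=> m n Mm Mn mn; rewrite -!rk//; exact: inc.
- rewrite rB; apply: le_omega1_ext => c; rewrite osupP; last first.
    by apply: sub_countable (card_image_le _ _) (countableP _).
  rewrite -sup; split=> H n; first by move=> Mn; rewrite rk//; apply: H; exists n.
  by move=> [m Mm <-]; rewrite -rk//; exact: H.
Qed.

(* The only consequence of uniformity used to compare two barriers.  It is not
   restricted to s in the tree, outside of which s has no extension and rank 0. *)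
Definition regular_ranks (M : set nat) (B : set (set nat)) : Prop :=
  forall (s : set nat) (b : omega1), finite_set s -> s `<=` M ->
  (b < tree_rank (tree B) s)%O ->
  exists k, forall m, M m -> k <= m -> (b <= tree_rank (tree B) (m |` s))%O.

(** A nonempty [s] with minimum [n] is treated in the section at [n], where the ranks agree; only
    the root needs the last hypothesis. *)
Lemma regular_ranks_step (M : set nat) (B : set (set nat)) :
  barrier M B ->
  (forall n, M n -> barrier (M `\` `I_n.+1) (section_family B n)) ->
  (forall n, M n -> regular_ranks (M `\` `I_n.+1) (section_family B n)) ->
  (forall b, (b < barrier_rank B)%O ->
    exists k, forall m, M m -> k <= m -> (b <= tree_rank (tree B) [set m])%O) ->
  regular_ranks M B.
Proof.
move=> bB bS rS r0 s b sfin sM.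
have [->|/set0P/is_min_ex[n sn]] := eqVneq s set0.
  by move=> /r0[k kP]; exists k => m Mm km; rewrite setU0; exact: kP.
have ns : s n by case: sn.
have Mn := sM _ ns; have sD := is_minD1 sn.
rewrite -{1}(setD1K ns) -(tree_rank_section bB (bS n Mn) sD) => /(rS n Mn)[].
- by apply: sub_finite_set sfin => x [].
- by move=> x xs; split; [apply: sM; case: xs|exact: sD].
move=> k kP; exists (maxn n.+1 k) => m Mm; rewrite geq_max => /andP[nm km].
have -> : m |` s = n |` (m |` (s `\ n)) by rewrite setUCA setD1K.
rewrite -(tree_rank_section bB (bS n Mn)) => [|x [->|/sD//]]; last by move=> /=; lia.
by apply: kP => //; split=> //=; lia.
Qed.

(** By induction on uniformity. In {∅} all ranks vanish; for singletons all ranks are at most 1, so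
    [b] is zero. At the root, the singletons have constant rank [beta] in the successor case, and
    increasing ranks that pass any [b] below their supremum in the limit case. *)
Lemma uniform_regular (M : set nat) (B : set (set nat)) :
  uniform_barrier M B -> regular_ranks M B.
Proof.
elim=> {M B} [M Minf|M Minf|M B beta bB r1 uS IH rB rS|M B bB r1 uS IH _ inc sup].
- move=> s b _ _; rewrite ltNge => /negP[].
  have bB := uniform_is_barrier (uniform_barrier0 Minf).
  apply: le_trans (ozero_le b); rewrite -(barrier_rank_set0 bB erefl).
  apply/tree_rank_leP; first exact: tree_ext_wf bB _.
  move=> t [[_ [u /= -> [t0 _]]] [st _] nst]; case: nst.
  move/(subset_trans st): (t0); move: t0; rewrite !subset0.
  by move=> -> ->.
- move=> s b _ _ bs; exists 0 => m _ _; apply: le_trans (ozero_le _).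
  rewrite -lt_osucc; apply: (lt_le_trans bs).
  have bB := barrier_singletons Minf.
  rewrite -(barrier_rank_singletons Minf).
  apply/tree_rank_leP => [|t ts]; first exact: tree_ext_wf bB _.
  have [Tt [st _] nst] := ts; apply: (tree_rank_lt bB); split=> //.
    exact: init_seg0.
  by move=> t0; apply: nst; apply/seteqP; split=> //; rewrite -t0.
- apply: regular_ranks_step => // [n Mn|b]; first exact/uniform_is_barrier/uS.
  by rewrite rB lt_osucc => bb; exists 0 => m Mm _; rewrite rS.
- apply: regular_ranks_step => // [n Mn|b]; first exact/uniform_is_barrier/uS.
  rewrite -sup => bs; apply: contrapT => H; move: bs; apply/negP.
  rewrite -leNgt; apply/osupP.
    by apply: sub_countable (card_image_le _ _) (countableP _).
  move=> _ [n Mn <-]; rewrite leNgt; apply/negP => bn; apply: H.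
  exists n => m Mm; rewrite leq_eqVlt => /orP[/eqP<-|nm]; first exact: ltW.
  by apply/ltW/(lt_trans bn)/inc.
Qed.

(** * Pullbacks along increasing maps *)

(** For [h = id] this is the restriction of [B] to subsets of [M], the form used in the successor
    step of the construction. *)
Definition pullback (h : nat -> nat) (M : set nat) (B : set (set nat)) :
  set (set nat) := [set s | s `<=` M /\ B (h @` s)].

Lemma image_preimage_sub (h : nat -> nat) (s t : set nat) :
  t `<=` h @` s -> h @` (s `&` h @^-1` t) = t.
Proof.
move=> ts; apply/seteqP; split=> [_ [x [_ tx] <-]//|y ty].
by have [x sx xy] := ts _ ty; exists x => //; split=> //; rewrite /preimage/= xy.
Qed.

Section StrictMono.
Variables (h : nat -> nat) (hmono : {homo h : m n / m < n}).

Let hinj : injective h := strict_mono_inj hmono.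

Let hltn m n : h m < h n -> m < n.
Proof.
by have [//|nm|->] := ltngtP m n; [have := hmono nm; lia|rewrite ltnn].
Qed.

Lemma barrier_pullback (M N : set nat) (B : set (set nat)) :
  infinite_set N -> h @` N `<=` M -> barrier M B -> barrier N (pullback h N B).
Proof.
move=> Ninf hN [Minf Bfin anti dense]; split=> //.
- move=> s [sN Bs]; split=> //; apply: (image_inj_finite hinj).
  by have [] := Bfin _ Bs.
- move=> s t [sN Bs] [tN Bt] st; apply: (image_inj_eq hinj).
  by apply: anti => //; exact: image_subset.
(* Density of [B] is applied to the image of [A], and the segment found is pulled back into [A]. *)
- move=> A Ainf AN; have [|x [y Ay <-]|t Bt [tA tA']] := dense (h @` A).
  + by move=> /(image_inj_finite hinj).
  + by apply: hN; exists y => //; exact: AN.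
  + have tE := image_preimage_sub tA; exists (A `&` h @^-1` t).
      by split; [move=> x [/AN]|rewrite tE].
    split=> [x []//|m n [Am tm] An nm]; split=> //=.
    by apply: (tA' (h m)) => //; exact: hmono.
Qed.

Lemma section_pullback (N : set nat) (B : set (set nat)) (n : nat) : N n ->
  section_family (pullback h N B) n =
  pullback h (N `\` `I_n.+1) (section_family B (h n)).
Proof.
move=> Nn; apply/seteqP; split=> s.
  move=> /section_familyP[sn [sN]]; rewrite image_U1 => Bs.
  split; first by move=> x sx; split; [apply: sN; right|exact: sn].
  apply/section_familyP; split=> // _ [x /sn /= nx <-].
  by have := @hmono n x; lia.
move=> [sN /section_familyP[hs Bs]]; apply/section_familyP; split.
  by move=> x /sN[].
by split; [move=> x [->|/sN[]]|rewrite image_U1].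
Qed.

Lemma pullback_set0 (N : set nat) (B : set (set nat)) :
  pullback h N B set0 <-> B set0.
Proof.
by rewrite /pullback/= image_set0; split=> [[]//|B0]; split=> //; exact: sub0set.
Qed.

Lemma image_shift (M N : set nat) (n : nat) : h @` N `<=` M ->
  h @` (N `\` `I_n.+1) `<=` M `\` `I_(h n).+1.
Proof.
move=> hN _ [x [Nx /= nx] <-]; split; first by apply: hN; exists x.
by move=> /= hx; apply: nx; rewrite ltnS leqNgt; apply/negP => /hmono; lia.
Qed.

(** By induction on uniformity, because the section of a pullback at [n] is a pullback of the
    section at [h n]. The ranks of the singletons form a subfamily of the original ones: constant,
    or increasing and cofinal. *)
Lemma uniform_pullback (M N : set nat) (B : set (set nat)) :
  uniform_barrier M B -> infinite_set N -> h @` N `<=` M ->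
  uniform_barrier N (pullback h N B) /\
  barrier_rank (pullback h N B) = barrier_rank B.
Proof.
move=> uB; elim: uB N => {M B}
  [M Minf|M Minf|M B beta bB r1 uS IH rB rS|M B bB r1 uS IH lim inc sup]
  N Ninf hN.
- suff -> : pullback h N [set set0] = [set set0].
    by split=> //; exact: uniform_barrier0.
  apply/seteqP; split=> [s [_ /= s0]|_ ->]; last exact/pullback_set0.
  by apply: (image_inj_eq hinj); rewrite s0 image_set0.
- suff -> : pullback h N [set [set n] | n in M] = [set [set n] | n in N].
    by rewrite !barrier_rank_singletons//; split=> //; exact: uniform_barrier1.
  apply/seteqP; split=> [s [sN [m Mm ms]]|_ [n Nn <-]]; last first.
    split; first by move=> _ ->.
    by exists (h n); [apply: hN; exists n|rewrite image_set1].
  have [n sn nm] : (h @` s) m by rewrite -ms.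
  exists n; first exact: sN.
  by apply: (image_inj_eq hinj); rewrite image_set1 nm.
- have nB0 : ~ B set0.
    by move=> /(barrier_rank_set0 bB) r0; move: r1; rewrite r0 ltNge ozero_le.
  rewrite rB; apply: uniform_succ; first exact: barrier_pullback hN bB.
  + by move=> /pullback_set0.
  + move=> n Nn; have Mn : M (h n) by apply: hN; exists n.
    rewrite section_pullback//.
    exact: (IH _ Mn _ (infinite_setD Ninf (finite_II _)) (image_shift hN)).1.
  + move=> n Nn; have Mn : M (h n) by apply: hN; exists n.
    rewrite section_pullback//.
    rewrite (IH _ Mn _ (infinite_setD Ninf (finite_II _)) (image_shift hN)).2.
    by rewrite (barrier_rank_section bB (uniform_is_barrier (uS _ Mn))) rS.
- have nB0 : ~ B set0.
    by move=> /(barrier_rank_set0 bB) r0; move: r1; rewrite r0 ltNge ozero_le.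
  have rk n : N n -> barrier_rank (section_family (pullback h N B) n) =
      tree_rank (tree B) [set h n].
    move=> Nn; have Mn : M (h n) by apply: hN; exists n.
    rewrite section_pullback//.
    rewrite (IH _ Mn _ (infinite_setD Ninf (finite_II _)) (image_shift hN)).2.
    by rewrite (barrier_rank_section bB (uniform_is_barrier (uS _ Mn))).
  apply: uniform_limit => //; first exact: barrier_pullback hN bB.
  + by move=> /pullback_set0.
  + move=> n Nn; have Mn : M (h n) by apply: hN; exists n.
    rewrite section_pullback//.
    exact: (IH _ Mn _ (infinite_setD Ninf (finite_II _)) (image_shift hN)).1.
  + move=> m n Nm Nn mn; rewrite !rk//; apply: inc; last exact: hmono.
      by apply: hN; exists m.
    by apply: hN; exists n.
  + move=> b; rewrite -sup osupP; last first.
      by apply: sub_countable (card_image_le _ _) (countableP _).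
    split=> [H _ [m Mm <-]|H n Nn]; last first.
      by rewrite rk//; apply: H; exists (h n) => //; apply: hN; exists n.
    (* An increasing map dominates the identity, so the image of [N] passes [m] and the ranks along
       it keep the same supremum. *)
    have hleq i : i <= h i.
      by elim: i => // i ih; apply: (leq_ltn_trans ih); exact: hmono.
    have [n Nn mn] := infinite_set_unbounded m.+1 Ninf.
    apply: le_trans (H n Nn); rewrite rk//; apply/ltW/inc => //.
      by apply: hN; exists n.
    exact: leq_trans mn (hleq n).
Qed.

End StrictMono.

(** * Existence of uniform barriers of every rank *)

Definition glue (E : nat -> set (set nat)) : set (set nat) :=
  [set s | exists2 n, is_min n s & E n (s `\ n)].

Lemma is_min_uniq (m n : nat) (s : set nat) : is_min m s -> is_min n s -> m = n.
Proof. by move=> [sm mm] [sn mn]; apply/eqP; rewrite eqn_leq mm// mn. Qed.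

Lemma glueP (E : nat -> set (set nat)) (n : nat) (s : set nat) :
  s `<=` ~` `I_n.+1 -> glue E (n |` s) <-> E n s.
Proof.
move=> sn; split=> [[m ms]|Es].
  by rewrite -(is_min_uniq (is_min_U1 sn) ms) setU1D1.
by exists n; [exact: is_min_U1|rewrite setU1D1].
Qed.

Lemma section_glue (E : nat -> set (set nat)) (n : nat) :
  (forall s, E n s -> s `<=` ~` `I_n.+1) -> section_family (glue E) n = E n.
Proof.
move=> En; apply/seteqP; split=> [s /section_familyP[sn /glueP]|s Es]; first exact.
by apply/section_familyP; split; [exact: En|apply/glueP => //; exact: En].
Qed.

(* If {n} u s is included in {m} u t with m < n, coherence gives v in E m inside s,
   hence inside t, so v = t by the antichain property, but n is in t and not in v. *)
Lemma barrier_glue (E : nat -> set (set nat)) :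
  (forall n, barrier (setT `\` `I_n.+1) (E n)) ->
  (forall m n s, m < n -> E n s -> exists2 t, E m t & t `<=` s) ->
  barrier setT (glue E).
Proof.
move=> bE coh; have sub n s : E n s -> s `<=` ~` `I_n.+1.
  by have [_ H _ _] := bE n; move=> /H[_ sn] x /sn[].
split=> //; first exact: infinite_nat.
- move=> s [n [sn _]]; have [_ H _ _] := bE n => /H[fs _]; split=> //.
  by rewrite -(setD1K sn) finite_setU.
- move=> s t [n [sn ns] Es] [m [tm mt] Et] st.
  have := mt n (st _ sn); rewrite leq_eqVlt => /orP[/eqP mn|mn].
    rewrite -mn in Es sn *; rewrite -(setD1K sn) -(setD1K tm); congr (_ |` _).
    have [_ _ anti _] := bE m; apply: anti => // x [sx xm]; split=> //; exact: st.
  have [u Eu us] := coh _ _ _ mn Es.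
  have ut : u = t `\ m.
    have [_ _ anti _] := bE m; apply: anti => // x /us[sx xn].
    split; first exact: st.
    by move=> /= xm; have := ns x sx; lia.
  have : u n by rewrite ut; split; [exact: st|move=> /=; lia].
  by move=> /us[_ /(_ erefl)].
- move=> N Ninf _; have [n nN] := is_min_ex (infinite_setN0 Ninf).
  have Nn : N n by case: nN.
  have [_ _ _ dense] := bE n; have ND := is_minD1 nN.
  have [| |s Es sN] := dense (N `\ n).
  + exact: infinite_setD (finite_set1 n).
  + by move=> x /ND.
  exists (n |` s); first by apply/glueP => //; exact: sub.
  by rewrite -(setD1K Nn); apply/init_segU1P => //; exact: sub Es.
Qed.

(** The countably many ordinals below [alpha] are enumerated by [e]. Each term of [a] is taken above
    its predecessor and at least the current value of [e]; it stays below [alpha] because a limit is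
    closed under successor. *)
Lemma limit_cofinal (alpha : omega1) : is_limit alpha ->
  exists a : nat -> omega1, [/\ {homo a : m n / m < n >-> (m < n)%O},
    forall n, (a n < alpha)%O &
    forall b, (forall n, (a n <= b)%O) <-> (alpha <= b)%O].
Proof.
move=> [n0 nS]; have a0 : (ozero < alpha)%O.
  by rewrite lt_neqAle ozero_le andbT; apply/eqP => E; exact: n0.
have succ b : (b < alpha)%O -> (osucc b < alpha)%O.
  move=> ba; rewrite lt_neqAle; apply/andP; split; last exact/osuccP.
  by apply/eqP => E; apply: nS; exists b.
have /countable_injP[f fi] : countable [set b : omega1 | (b < alpha)%O].
  by apply: sub_countable (countable_initial alpha); apply: subset_card_le => b /ltW.
pose e n := xget ozero [set b | (b < alpha)%O /\ f b = n].
have ea n : (e n < alpha)%O by rewrite /e; case: xgetP => // b _ [].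
have eS b : (b < alpha)%O -> e (f b) = b.
  move=> ba; rewrite /e; case: xgetP => [c _ [ca /fi]|/(_ b)[]//].
  by apply; apply/mem_set.
pose a := fix a n := if n is n'.+1 then Order.max (osucc (a n')) (e n) else e 0.
have aS n : (a n < a n.+1)%O by rewrite /= lt_max lt_osucc lexx.
have amono : {homo a : m n / m < n >-> (m < n)%O}.
  by apply: homo_ltn aS; exact: lt_trans.
have aa n : (a n < alpha)%O by elim: n => //= n IH; rewrite gt_max succ//= ea.
have le_ea n : (e n <= a n)%O by case: n => //= n; rewrite le_max lexx orbT.
exists a; split=> // b; split=> [H|ab n]; last exact/ltW/(lt_le_trans (aa n)).
(* The term at index [f b] is only known to be at least [b]; the next one exceeds it. *)
rewrite leNgt; apply/negP => ba; have := H (f b).+1; apply/negP.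
by rewrite -ltNge; apply: le_lt_trans (aS _); rewrite -{1}(eS b ba).
Qed.

Lemma tree_rank_U1_lt (M : set nat) (B : set (set nat)) (u : set nat) (m : nat) :
  barrier M B -> u `<=` `I_m -> tree B (m |` u) ->
  (tree_rank (tree B) (m |` u) < tree_rank (tree B) u)%O.
Proof.
move=> bB um Tm; apply: (tree_rank_lt bB); split=> //; first exact: init_segU1.
by move=> uE; have : u m by [rewrite uE; left]; move=> /um /=; rewrite ltnn.
Qed.

(* The strict inequality survives adding a large point: rank_i drops strictly while
   rank_j eventually stays at least the former value of rank_i. *)
Lemma sparse_domination (D : nat -> set (set nat)) :
  (forall n, barrier setT (D n)) -> (forall n, regular_ranks setT (D n)) ->
  (forall i j, i < j -> (barrier_rank (D i) < barrier_rank (D j))%O) ->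
  exists2 h : nat -> nat, {homo h : m n / m < n} &
  forall i j s, i < j -> finite_set s -> s `<=` ~` `I_j.+1 ->
  (exists2 t, D i t & t `<=` h @` s) \/
  (tree_rank (tree (D i)) (h @` s) < tree_rank (tree (D j)) (h @` s))%O.
Proof.
move=> bD rD incD.
(* One step of the induction: strict domination at [u] persists after adding [m], as long as the
   tree of [D i] is not left. *)
pose ok i j m u :=
  (tree_rank (tree (D i)) u < tree_rank (tree (D j)) u)%O ->
  tree (D i) (m |` u) ->
  (tree_rank (tree (D i)) (m |` u) < tree_rank (tree (D j)) (m |` u))%O.
(* A single threshold serves all indices below [p] and all subsets of [0, p), these being finite in
   number. *)
have : forall p, exists k, forall i m, i < p -> k <= m ->
    forall j, j < p -> forall u, u `<=` `I_p -> ok i j m u.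
  move=> p; apply: eventually_bounded => i _.
  have [j _|k kP] := @eventually_bounded p
    (fun j m => forall u, u `<=` `I_p -> ok i j m u); last first.
    by exists k => m km j jp; exact: kP.
  have [u up|k kP] := @eventually_powerset p (fun u m => ok i j m u); last first.
    by exists k => m km u up; exact: kP.
  have [lt_ij|nlt] := boolP (tree_rank (tree (D i)) u < tree_rank (tree (D j)) u)%O;
    last by exists 0 => m _ /(negP nlt).
  have [||k kP] := rD j u _ _ _ lt_ij => //.
    exact: sub_finite_set up (finite_II p).
  exists (maxn k p) => m; rewrite geq_max => /andP[km pm] _ Tm.
  apply: lt_le_trans (kP m I km); apply: (tree_rank_U1_lt (bD i)) => // x /up /=.
  by move=> xp; exact: leq_trans xp pm.
move=> /choice[K KP].
(* With [p = (h n').+1], all earlier values of [h] and all indices up to [n'] lie below [p], and the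
   new value reaches the threshold [K p]. *)
pose h := fix h n := if n is n'.+1 then maxn (h n').+1 (K (h n').+1) else 0.
have hmono : {homo h : m n / m < n}.
  by apply: homo_ltn => [y x z|n]; [exact: ltn_trans|rewrite /= leq_max leqnn].
have hleq n : n <= h n.
  by elim: n => // n IH; apply: (leq_ltn_trans IH); exact: hmono.
exists h => // i j s ij /finite_set_sub_I[N].
elim: N s => [|N IH] s sN sj.
  right; have -> : s = set0 by rewrite -subset0 => x /sN.
  by rewrite image_set0; exact: incD.
have [|[t tN sE]] := sub_I_split sN; first by move=> sN'; exact: IH.
rewrite sE image_U1; have [||[u Du ut]|lt_ij] := IH t => //.
- by move=> x tx; apply: sj; rewrite sE; right.
- by left; exists u => // x /ut; right.
have [|[u Du [us _]]|Tm] := @barrier_dichotomy (D i) (h N |` h @` t) (bD i).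
- rewrite finite_setU; split=> //.
  exact: finite_image (sub_finite_set tN (finite_II N)).
- by left; exists u.
(* Since [s] lies above [j], its top element [N] is positive, so [h N] was chosen by the successor
   clause, with [i] and [j] in range. *)
right; have jN : j < N.
  by have /sj/= : s N by [rewrite sE; left]; lia.
case: N jN {IH sN} tN sE Tm => // N jN tN sE Tm.
apply: (KP (h N).+1) => //; first by have := hleq N; lia.
- by rewrite /= leq_max leqnn orbT.
- by have := hleq N; lia.
- move=> _ [x /tN/= xN <-]; rewrite ltnS.
  have [->//|/hmono/ltnW//] : x = N \/ x < N by lia.
Qed.

Lemma wf_omega1 (P : omega1 -> Prop) :
  (forall a, (forall b, (b < a)%O -> P b) -> P a) -> forall a, P a.
Proof.
move=> IH a; apply: contrapT => nPa.
have [|b nPb min] := @omega1_min [set b | ~ P b]; first by exists a.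
apply: nPb; apply: IH => c cb; apply: contrapT => /min.
by rewrite leNgt cb.
Qed.

Lemma uniform_barrier_ex (alpha : omega1) :
  exists2 B, uniform_barrier setT B & barrier_rank B = alpha.
Proof.
elim/wf_omega1: alpha => alpha IH.
have [->|a0] := pselect (alpha = ozero).
  have u0 := uniform_barrier0 infinite_nat; exists [set set0] => //.
  by rewrite (barrier_rank_set0 (uniform_is_barrier u0)).
have sub h n D s : pullback h (setT `\` `I_n.+1) D s -> s `<=` ~` `I_n.+1.
  by move=> [sn _] x /sn[].
have glue0 E : ~ glue E set0 by move=> [n [[]]].
have infD n : infinite_set ([set: nat] `\` `I_n.+1).
  exact: infinite_setD infinite_nat (finite_II _).
have [[beta aE]|nS] := pselect (exists beta, alpha = osucc beta).
  have [|D uD rD] := IH beta; first by rewrite aE lt_osucc.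
  (* All [E n] restrict one barrier, so coherence holds with the member itself as witness. *)
  pose E n := pullback id (setT `\` `I_n.+1) D.
  have uE n : uniform_barrier (setT `\` `I_n.+1) (E n) /\ barrier_rank (E n) = beta.
    by rewrite -rD; apply: uniform_pullback uD _ _ => // m k.
  have bG : barrier setT (glue E).
    apply: barrier_glue => [n|m n s mn [sn Ds]]; first exact: uniform_is_barrier (uE n).1.
    by exists s => //; split=> // x /sn[_ /= xn]; split=> //=; lia.
  have [n _|n _|uG rG] := uniform_succ (beta := beta) bG (@glue0 E).
  - by rewrite section_glue; [exact: (uE n).1|exact: sub].
  - by rewrite section_glue; [exact: (uE n).2|exact: sub].
  - by exists (glue E) => //; rewrite aE.
have lim : is_limit alpha by [].
have [a [amono aa asup]] := limit_cofinal lim.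
have /choice[D DP] n : exists B, uniform_barrier setT B /\ barrier_rank B = a n.
  by have [B uB rB] := IH _ (aa n); exists B.
have bD n := uniform_is_barrier (DP n).1.
have [n|i j ij|h hmono hP] := sparse_domination bD.
- exact: uniform_regular (DP n).1.
- by rewrite (DP i).2 (DP j).2; exact: amono.
pose E n := pullback h (setT `\` `I_n.+1) (D n).
have uE n : uniform_barrier (setT `\` `I_n.+1) (E n) /\ barrier_rank (E n) = a n.
  by rewrite -(DP n).2; apply: uniform_pullback (DP n).1 _ _.
have bG : barrier setT (glue E).
  apply: barrier_glue => [n|i j s ij Es]; first exact: uniform_is_barrier (uE n).1.
  have [_ Efin _ _] := uniform_is_barrier (uE j).1.
  (* The image of [s] is a member of [D j] and has rank zero there, so strict domination is
     impossible and the other alternative holds. *)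
  have [t Dt ts] : exists2 t, D i t & t `<=` h @` s.
    have [||//|] := hP i j s ij; [by have [] := Efin _ Es|exact: sub Es|].
    by case: Es => _ Ds; rewrite (tree_rank_leaf (bD j) Ds) ltNge ozero_le.
  exists (s `&` h @^-1` t); last by move=> x [].
  split; last by rewrite image_preimage_sub.
  by move=> x [/(sub _ _ _ _ Es)/= xj _]; split=> //=; lia.
have secE n : section_family (glue E) n = E n by apply: section_glue; exact: sub.
have [n _|m n _ _ mn|b|uG rG] := uniform_limit bG (@glue0 E) lim.
- by rewrite secE; exact: (uE n).1.
- by rewrite !secE (uE m).2 (uE n).2; exact: amono.
- rewrite -asup; split=> H n => [|_]; last by rewrite secE (uE n).2.
  by have := H n I; rewrite secE (uE n).2.
by exists (glue E).
Qed.

(** * Comparison of barriers *)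

(** [h m] is the largest [n <= m] with [K n <= m], or 0 if there is none. A given [n] is eligible
    once [m] reaches both [n] and [K n], so [h] tends to infinity even when [K] is not monotone. *)
Lemma slow_inverse (K : nat -> nat) : exists h : nat -> nat,
  [/\ forall n, exists k, forall m, k <= m -> n <= h m,
      forall m, h m <= m & forall m, 0 < h m -> K (h m) <= m].
Proof.
have /choice[h hP] m : exists n, [/\ n <= m, 0 < n -> K n <= m &
    forall i, i <= m -> K i <= m -> i <= n].
  pose P n := (n == 0) || ((n <= m) && (K n <= m)).
  have exP : exists n, P n by exists 0.
  have ubP n : P n -> n <= m by move=> /orP[/eqP->|/andP[]].
  case: (ex_maxnP exP ubP) => n Pn maxn; exists n; split; first exact: ubP.
    by move: Pn => /orP[/eqP->//|/andP[]].
  by move=> i im Kim; apply: maxn; rewrite /P im Kim orbT.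
exists h; split=> [n|m|m]; last 2 first.
- by have [] := hP m.
- by have [] := hP m.
exists (maxn n (K n)) => m; rewrite geq_max => /andP[nm Km].
by have [_ _] := hP m; exact.
Qed.

(** The last property serves twice: with [h m <= m] it makes [h] increasing on [M'], and it puts the
    points of [M'] preceding [n] below [h n], where the threshold for [h n] is valid. *)
Lemma sparse_subset (h : nat -> nat) (M : set nat) :
  (forall n, exists k, forall m, k <= m -> n <= h m) -> infinite_set M ->
  exists M', [/\ infinite_set M', M' `<=` M, forall m, M' m -> 0 < h m &
    forall m n, M' m -> M' n -> m < n -> m < h n].
Proof.
move=> hub Minf.
have /choice[g gP] p : exists m, [/\ M m, p < m & p < h m].
  have [k kP] := hub p.+1.
  have [m Mm] := infinite_set_unbounded (maxn p.+1 k) Minf.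
  by rewrite geq_max => /andP[pm km]; exists m; split=> //; exact: kP.
(* The exponent [n.+1] makes even the first point a value of [g], hence a point of [M] with positive
   [h]. *)
pose c n := iter n.+1 g 0.
have cmono : {homo c : m n / m < n}.
  by apply: homo_ltn => [y x z|n]; [exact: ltn_trans|have [] := gP (c n)].
exists (range c); split.
- apply: unbounded_infinite_set => k; exists (c k); first by exists k.
  by elim: k => // k IH; apply: (leq_ltn_trans IH); exact: cmono.
- by move=> _ [n _ <-]; have [] := gP (iter n g 0).
- by move=> _ [n _ <-]; have [_ _] := gP (iter n g 0); exact: leq_ltn_trans.
- move=> _ _ [m _ <-] [n _ <-] cmn.
  have mn : m < n.
    by rewrite ltnNge leq_eqVlt; apply/negP => /orP[/eqP nm|/cmono];
      [rewrite nm in cmn|]; lia.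
  case: n {cmn} mn => // n; rewrite ltnS => mn.
  have [_ _] := gP (c n); apply: leq_ltn_trans.
  by move: mn; rewrite leq_eqVlt => /orP[/eqP->//|/cmono/ltnW].
Qed.

(** Induction on the top element [N] of [s]. Adding [h N] on the side of [C] lowers the rank
    strictly; by regularity, adding [N] on the side of [B] keeps the rank at least the lowered
    value, provided [N] is large compared with [h N]. *)
Lemma slow_domination (B C : set (set nat)) :
  barrier setT C -> regular_ranks setT B ->
  (barrier_rank C <= barrier_rank B)%O ->
  exists h : nat -> nat, [/\ forall n, exists k, forall m, k <= m -> n <= h m,
    forall m, h m <= m & forall M s,
    (forall m, M m -> 0 < h m) ->
    (forall m n, M m -> M n -> m < n -> m < h n) ->
    finite_set s -> s `<=` M ->
    (exists2 t, C t & init_seg t (h @` s)) \/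
    (tree_rank (tree C) (h @` s) <= tree_rank (tree B) s)%O].
Proof.
move=> bC rB CB.
(* Here [n] stands for [h m] and [u] for the image of [s]. *)
pose ok n u s m := (tree_rank (tree C) u <= tree_rank (tree B) s)%O ->
  tree C (n |` u) ->
  (tree_rank (tree C) (n |` u) <= tree_rank (tree B) (m |` s))%O.
have : forall n, exists k, forall u m, u `<=` `I_n -> k <= m ->
    forall s, s `<=` `I_n -> ok n u s m.
  move=> n; apply: eventually_powerset => u un.
  have [s sn|k kP] := @eventually_powerset n (fun s m => ok n u s m); last first.
    by exists k => m km s sn; exact: kP.
  have [[le_us Tu]|nus] := pselect
      ((tree_rank (tree C) u <= tree_rank (tree B) s)%O /\ tree C (n |` u)); last first.
    by exists 0 => m _ le_us Tu; exfalso; apply: nus.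
  (* The drop of rank in [C] supplies the strict inequality that regularity of [B] requires. *)
  have lt_us := lt_le_trans (tree_rank_U1_lt bC un Tu) le_us.
  have [||k kP] := rB s _ _ _ lt_us => //.
    exact: sub_finite_set sn (finite_II n).
  by exists k => m km _ _; exact: kP.
move=> /choice[K KP]; have [h [hub hle hK]] := slow_inverse K.
exists h; split=> // M s h0 hM /finite_set_sub_I[N].
elim: N s => [|N IH] s sN sM.
  right; have -> : s = set0 by rewrite -subset0 => x /sN.
  by rewrite image_set0.
have [|[t tN sE]] := sub_I_split sN; first by move=> sN'; exact: IH.
have MN : M N by apply: sM; rewrite sE; left.
have tM : t `<=` M by move=> x tx; apply: sM; rewrite sE; right.
(* Both [t] and its image lie below [h N], so the threshold [K (h N)] covers them. *)
have th : t `<=` `I_(h N) by move=> x tx; exact: hM (tM _ tx) MN (tN _ tx).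
have hth : h @` t `<=` `I_(h N).
  by move=> _ [x /th/= xN <-]; exact: leq_ltn_trans (hle x) xN.
rewrite sE image_U1; have [//|[u Cu ut]|le_ts] := IH t tN.
  by left; exists u => //; apply: (init_seg_trans ut); exact: init_segU1.
have [|[u Cu us]|Tm] := @barrier_dichotomy C (h N |` h @` t) bC.
- rewrite finite_setU; split=> //.
  exact: finite_image (sub_finite_set tN (finite_II N)).
- by left; exists u.
by right; apply: (KP (h N)) => //; exact/hK/h0.
Qed.

Lemma init_seg_image (h : nat -> nat) (N s : set nat) :
  (forall m n, N m -> N n -> m < n -> h m < h n) ->
  init_seg s N -> init_seg (h @` s) (h @` N).
Proof.
move=> hN [sN sN']; split=> [|_ _ [m sm <-] [n Nn <-] nm]; first exact: image_subset.
exists n => //; apply: (sN' m) => //; rewrite ltnNge leq_eqVlt.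
by apply/negP => /orP[/eqP mn|/(hN _ _ (sN _ sm) Nn)]; [rewrite mn in nm|]; lia.
Qed.

Lemma barrier_seq_compact_le (X : topologicalType) (B C : set (set nat)) :
  uniform_barrier setT B -> barrier setT C ->
  (barrier_rank C <= barrier_rank B)%O ->
  barrier_seq_compact X B -> barrier_seq_compact X C.
Proof.
move=> uB bC CB compB f; have bB := uniform_is_barrier uB.
have [h [hub hle hP]] := slow_domination bC (uniform_regular uB) CB.
(* The default [set0] does not occur for members of [B] inside the set [M'] chosen below: their rank
   is zero, so domination yields a member of [C]. *)
pose lead s := xget set0 [set t | C t /\ init_seg t (h @` s)].
have [M Minf [x cvg_x]] := compB (f \o lead).
have [M' [M'inf M'M h0 hM']] := sparse_subset hub Minf.
have hmono m n : M' m -> M' n -> m < n -> h m < h n.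
  by move=> Mm Mn mn; apply: leq_ltn_trans (hle m) _; exact: hM'.
exists (h @` M').
  apply: unbounded_infinite_set => k; have [k' k'P] := hub k.
  have [m Mm km] := infinite_set_unbounded k' M'inf.
  by exists (h m); [exists m|exact: k'P].
exists x => U oU Ux; have [n nU] := cvg_x U oU Ux; exists n.
move=> _ [t [[Ct _] tM] <-].
have [_ Cfin Canti _] := bC; have [_ Bfin _ Bdense] := bB.
have [tfin _] := Cfin _ Ct.
pose t' := M' `&` h @^-1` t.
have t'E : h @` t' = t by apply: image_preimage_sub => y /tM[].
(* The member [s] of [B] that begins [N] may be shorter or longer than [t']; only the common
   extension [N] matters. Points of [t'] are at least [n] because [h m <= m]. *)
have [|||N [Ninf NM' t'N]] := @init_seg_extend (M' `\` `I_n) t'.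
- exact: infinite_setD (finite_II n).
- have [k tk] := finite_set_sub_I tfin; have [k' k'P] := hub k.
  apply: sub_finite_set (finite_II k') => m [_ /tk/= hk] /=.
  by rewrite ltnNge; apply/negP => /k'P; lia.
- move=> m [Mm /tM[_ /= hn]]; split=> //= mn; apply: hn.
  exact: leq_ltn_trans (hle m) mn.
have [s Bs sN] := Bdense _ Ninf (@subsetT _ _).
have [sfin _] := Bfin _ Bs.
have sM' : s `<=` M' `\` `I_n by apply: subset_trans NM'; case: sN.
have [u Cu us] : exists2 u, C u & init_seg u (h @` s).
  have [|//|] := hP M' s h0 hM' sfin; first by move=> m /sM'[].
  rewrite (tree_rank_leaf bB Bs) => /(tree_rank0_leaf bC); apply.
  exact: finite_image.
have hN m k : N m -> N k -> m < k -> h m < h k.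
  by move=> /NM'[Mm _] /NM'[Mk _]; exact: hmono.
(* Both are initial segments of the image of [N], hence comparable, hence equal by the antichain
   property of [C]. *)
have <- : lead s = t.
  rewrite /lead; case: xgetP => [v _ [Cv vs]|/(_ u)[]//].
  have vN := init_seg_trans vs (init_seg_image hN sN).
  have := init_seg_image hN t'N; rewrite t'E => tN.
  have [[vt _]|[tv _]] := init_seg_comparable vN tN; first exact: Canti.
  by apply/esym/Canti.
apply: nU; exists s => //; split; last by move=> m /sM'[/M'M].
by split=> // m /sM'[/M'M].
Qed.

Theorem corollary3p5 (X : topologicalType) (alpha : omega1) :
  (ordinal_seq_compact X alpha <->
   (forall B : set (set nat), uniform_barrier setT B ->
      barrier_rank B = alpha -> barrier_seq_compact X B)) /\
  (ordinal_seq_compact X alpha <->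
   (exists B : set (set nat),
      [/\ uniform_barrier setT B, barrier_rank B = alpha &
          barrier_seq_compact X B])).
Proof.
(* Existence keeps (2) from being vacuous: [D] gives (3) from (1) and carries (2) to (1). *)
have [D uD rD] := uniform_barrier_ex alpha.
have all_unif : ordinal_seq_compact X alpha -> forall B : set (set nat),
    uniform_barrier setT B -> barrier_rank B = alpha -> barrier_seq_compact X B.
  by move=> compX B uB rB; apply: compX => //; exact: uniform_is_barrier.
have some_unif B : uniform_barrier setT B -> barrier_rank B = alpha ->
    barrier_seq_compact X B -> ordinal_seq_compact X alpha.
  move=> uB rB compB C bC rC; apply: barrier_seq_compact_le uB bC _ compB.
  by rewrite rC rB.
split; split=> [compX|].
- exact: all_unif.
- by move=> compX; exact: some_unif uD rD (compX D uD rD).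
- by exists D; split=> //; exact: all_unif.
- by move=> [B [uB rB compB]]; exact: some_unif uB rB compB.
Qed.
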